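(* Let $k\in\mathbb{N}\cup\{0,\infty\}$ and let $M$, $N$ be $C^k$-manifolds (with or without boundary) with a countable base, equipped with metrics compatible with their topologies. Then $$d_{GH}^{C}(M,N)=d_{GH}^{C_k}(M,N).$$
   Context: Let $\mathbb{R}^n_+=\{(x_1,\dots,x_n)\in\mathbb{R}^n: x_1\ge 0\}$. A $C^k$-manifold (with possibly empty boundary) is a Hausdorff space with a countable base together with a maximal $C^k$-atlas, i.e. a maximal family of charts $(U_i,\varphi_i)$ with the $U_i$ open and covering the space, each $\varphi_i$ a homeomorphism of $U_i$ onto an open subset of $\mathbb{R}^n_+$, and all transition maps $\varphi_i\circ\varphi_j^{-1}|_{\varphi_j(U_i\cap U_j)}$ of class $C^k$. Here a function on a subset open in $\mathbb{R}^n_+$ is called $C^k$ if it extends to a $C^k$ function on some open subset of $\mathbb{R}^n$. For $k=0$, $C^0=C$ (continuity). A map $f:M\to N$ of $C^k$-manifolds is $C^k$ if for every $x\in M$ there are charts $(U,\varphi)$ of $M$ with $x\in U$ and $(V,\psi)$ of $N$ with $f(x)\in V$, $f(U)\subset V$, such that $\psi\circ f\circ\varphi^{-1}$ is $C^k$. A metric on a manifold is compatible with the topology if it induces the topology of the manifold. For metric spaces $X,Y$ and maps $f:X\to Y$, $g:Y\to X$ put $\operatorname{dis} f=\sup_{a,a'\in X}|d_X(a,a')-d_Y(f(a),f(a'))|$, similarly $\operatorname{dis} g$, and $\operatorname{codis}(f,g)=\sup_{x\in X,\,y\in Y}|d_X(x,g(y))-d_Y(f(x),y)|$. The continuous Gromov--Hausdorff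 distance is $$d_{GH}^{C}(M,N)=\tfrac12\inf_{f,g}\max\{\operatorname{dis}f,\operatorname{dis}g,\operatorname{codis}(f,g)\},$$ the infimum being over all continuous $f:M\to N$, $g:N\to M$. The $C^k$ Gromov--Hausdorff distance $d_{GH}^{C_k}(M,N)$ is given by the same formula with the infimum over all $C^k$-maps $f:M\to N$, $g:N\to M$. Both take values in $[0,\infty]$ (infimum over the empty set is $\infty$). *)

(* Defs.v *)
From HB Require Import structures.
From mathcomp Require Import all_boot all_order all_algebra.
From mathcomp Require Import all_classical all_reals all_analysis.

Set Implicit Arguments.
Unset Strict Implicit.
Unset Printing Implicit Defensive.

Import Order.TTheory GRing.Theory Num.Theory.
Import numFieldNormedType.Exports.

Local Open Scope classical_set_scope.
Local Open Scope ring_scope.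

(* Orders of smoothness [k : option nat]: [Some j] is the finite order [j] and
   [None] is infinity. *)

Section smooth.
Context {R : realType} {n m : nat}.
Implicit Types (O A : set 'rV[R]_n) (f g : 'rV[R]_n -> 'rV[R]_m).

(* [f] is [C^(j+1)] when it is Fréchet differentiable and its differential is
   [C^j], i.e. (in finite dimension) [x |-> 'D_v f x] is [C^j] for every [v]. *)
Fixpoint Cfin (j : nat) O f : Prop :=
  match j with
  | 0%N => forall x, O x -> {for x, continuous f}
  | j'.+1 => (forall x, O x -> differentiable f x) /\
             (forall v : 'rV[R]_n, Cfin j' O ('D_v f))
  end.

Definition Ck_open (k : option nat) O f : Prop :=
  match k with
  | Some j => Cfin j O f
  | None => forall j, Cfin j O f
  end.

Definition Ck_on (k : option nat) A f : Prop :=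
  exists O g, [/\ open O, A `<=` O, Ck_open k O g & forall x, A x -> g x = f x].

End smooth.

(* The condition bears on the first coordinate; for [n = 0] there is none and
   the half-space is the one-point space. *)
Definition halfspace (R : realType) (n : nat) : set 'rV[R]_n :=
  [set x | forall i : 'I_n, nat_of_ord i = 0%N -> 0 <= x ord0 i].

(* A chart [(U, phi)] with its inverse. The two maps are total functions, but
   only [phi] on [U] and the inverse on [phi @` U] are meaningful. *)
Record chart (R : realType) (n : nat) (M : topologicalType) := Chart {
  chart_dom : set M ;
  chart_map : M -> 'rV[R]_n ;
  chart_inv : 'rV[R]_n -> M }.

Section manifold.
Context {R : realType}.

Definition chart_img n (M : topologicalType) (c : chart R n M) : set 'rV[R]_n :=
  chart_map c @` chart_dom c.

Record is_chart n (M : topologicalType) (c : chart R n M) : Prop := IsChart {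
  chart_dom_open : open (chart_dom c) ;
  chart_img_open : exists2 O : set 'rV[R]_n,
    open O & chart_img c = O `&` @halfspace R n ;
  chart_mapK : forall x, chart_dom c x -> chart_inv c (chart_map c x) = x ;
  chart_map_continuous : {within chart_dom c, continuous (chart_map c)} ;
  chart_inv_continuous : {within chart_img c, continuous (chart_inv c)} }.

Definition Ck_transition (k : option nat) n (M : topologicalType)
    (c d : chart R n M) : Prop :=
  Ck_on k (chart_map d @` (chart_dom c `&` chart_dom d))
    (chart_map c \o chart_inv d).

Record Ck_manifold (k : option nat) n (M : topologicalType)
    (A : set (chart R n M)) : Prop := CkManifold {
  manifold_hausdorff : hausdorff_space M ;
  manifold_countable_base : @second_countable M ;
  atlas_chart : forall c, A c -> is_chart c ;
  atlas_cover : forall x : M, exists2 c, A c & chart_dom c x ;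
  atlas_transition : forall c d, A c -> A d -> Ck_transition k c d ;
  atlas_maximal : forall c, is_chart c ->
    (forall d, A d -> Ck_transition k c d /\ Ck_transition k d c) -> A c }.

Definition Ck_map (k : option nat) m n (M N : topologicalType)
    (A : set (chart R m M)) (B : set (chart R n N)) (f : M -> N) : Prop :=
  forall x : M, exists c d,
    [/\ A c /\ B d,
        chart_dom c x,
        chart_dom d (f x),
        f @` chart_dom c `<=` chart_dom d &
        Ck_on k (chart_img c) (chart_map d \o f \o chart_inv c)].

End manifold.

Section gromov_hausdorff.
Context {R : realType}.
Local Open Scope ereal_scope.

(* Suprema are taken in [0, +oo], so the supremum of the empty set is 0. *)
Definition dis (X Y : metricType R) (f : X -> Y) : \bar R :=
  maxe 0 (ereal_sup [set `|mdist a.1 a.2 - mdist (f a.1) (f a.2)|%R%:E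
                    | a in [set: X * X]]).

Definition codis (X Y : metricType R) (f : X -> Y) (g : Y -> X) : \bar R :=
  maxe 0 (ereal_sup [set `|mdist a.1 (g a.2) - mdist (f a.1) a.2|%R%:E
                    | a in [set: X * Y]]).

Definition dGH_over (X Y : metricType R) (F : set (X -> Y)) (G : set (Y -> X))
    : \bar R :=
  (2^-1)%R%:E *
  ereal_inf [set maxe (maxe (dis p.1) (dis p.2)) (codis p.1 p.2)
            | p in F `*` G].

Definition dGH_C (M N : metricType R) : \bar R :=
  dGH_over [set f : M -> N | continuous f] [set g : N -> M | continuous g].

Definition dGH_Ck (k : option nat) m n (M N : metricType R)
    (A : set (chart R m M)) (B : set (chart R n N)) : \bar R :=
  dGH_over [set f : M -> N | Ck_map k A B f] [set g : N -> M | Ck_map k B A g].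

End gromov_hausdorff.

(* Main.v *)
From HB Require Import structures.
Require Import Defs.
From mathcomp Require Import all_boot all_order all_algebra.
From mathcomp Require Import all_classical all_reals all_analysis.
From mathcomp Require Import ring lra.

Set Implicit Arguments.
Unset Strict Implicit.
Unset Printing Implicit Defensive.

Import Order.TTheory GRing.Theory Num.Theory.
Import numFieldNormedType.Exports.

Local Open Scope classical_set_scope.
Local Open Scope ring_scope.

(** A [C^k] map is continuous, so one inequality holds because the infimum that
defines [dGH_C] ranges over more pairs. For the other one, every continuous
[f : M -> N] is uniformly approximated by [C^k] maps ([Ck_approximation]);
replacing [f] and [g] by maps at distance at most [e / 2] from them changes the
two distortions and the codistortion by at most [e] ([dGH_over_perturb]).

The approximation is a Whitney-type argument that uses neither embeddings of
the manifolds nor convolutions. Its elementary move is a flattening: in a chart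
of [N], replace [h] by [(1 - b) h + b h(p)], where [b] is a smooth bump function
that is [1] near [p]. The new map is constant, hence smooth, near [p]; it is
smooth wherever [h] was; it takes its values in the half-space because the
half-space is convex; and it is uniformly close to [h] as soon as [h] oscillates
little on the support of [b]. Convexity of balls keeps the last bound true
however many flattenings follow each other, so finitely many of them smooth [h]
near any compact set on which it is read in a single chart of [N]
([flatten_on_compact], [smooth_in_chart]). The supports of the bumps can avoid
a closed set near which the map is already smooth.

A compact set is then treated chart after chart; the smallness of each move
guarantees that the later charts still apply to the modified map
([smoothable_near_compact]). Finally [M] is covered by the interiors of
countably many compact sets, which are treated one after the other, with errors
in a geometric series, without modifying the map on the previous ones: the
sequence of maps is then stationary near every point, and its limit is smooth.
Since a map may be left alone where it is smooth, no locally finite cover is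
needed.

Smoothness is handled pointwise: [smooth_at] and [smooth_map_at] speak of the
germ of a map, which makes the flattening and the limit immediate, and a
[C^k] map is recovered at the end by restricting charts, which a maximal atlas
permits. *)

(** * Calculus of iterated Fréchet differentiability *)

Lemma near_eq_differentiable (R : realType) (V W : normedModType R)
    (f g : V -> W) (x : V) :
  (\near x, f x = g x) -> differentiable f x -> differentiable g x.
Proof.
move=> fg df; pose h := g - f.
have -> : g = f + h by rewrite /h addrC subrK.
apply: differentiableD => //.
have fgx : g x = f x by rewrite (nbhs_singleton fg).
have h0 : h \o shift x = cst (h x) + cst 0 +o_ 0 id.
  apply/eqaddoP => e e0.
  suff : \forall y \near 0, (h \o shift x) y = 0.
    apply: filterS => y.
    rewrite /= /cst /GRing.add/= => ->; rewrite /h.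
    have -> : (g - f) x = 0 by rewrite !fctE fgx subrr.
    rewrite [X in `|X|](_ : _ = 0) ?normr0; last first.
      by rewrite add0r -[LHS]/(- ((0 : W) + 0)) addr0 oppr0.
    by rewrite mulr_ge0 ?(ltW e0).
  move: fg; rewrite (near_shift 0) subr0.
  by apply: filterS => y; rewrite /h/= !fctE/= => ->; rewrite subrr.
(* [h] vanishes near [x], so that [0] is its linear part there *)
have d0 : 'd h x = cst 0 :> (V -> W).
  apply: (@diff_unique _ _ _ h (\0 : {linear V -> W}) x) => //.
  exact: cst_continuous.
by apply/diff_locallyP; rewrite d0; split => //; exact: cst_continuous.
Qed.

Section calculus.
Context {R : realType}.

(** Same recursion as [Cfin] with values in any normed module. Real-valued
functions are thus covered, so that products can be differentiated in [R] and
the results transferred to row vectors by coordinates. *)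
Fixpoint smooth_upto n (W : normedModType R) (j : nat) (O : set 'rV[R]_n)
    (f : 'rV[R]_n -> W) : Prop :=
  match j with
  | 0%N => forall x, O x -> {for x, continuous f}
  | j'.+1 => (forall x, O x -> differentiable f x) /\
             (forall v, smooth_upto j' O ('D_v f))
  end.

Lemma CfinE n m j (O : set 'rV[R]_n) (f : 'rV[R]_n -> 'rV[R]_m) :
  Cfin j O f <-> smooth_upto j O f.
Proof.
elim: j f => [//|j IH] f /=; split=> -[df Df]; split=> // v; exact/IH/Df.
Qed.

Section generic.
Context {n : nat} {W : normedModType R}.
Implicit Types (O : set 'rV[R]_n) (f g : 'rV[R]_n -> W).

Lemma smooth_upto_subset j O O' f : O' `<=` O ->
  smooth_upto j O f -> smooth_upto j O' f.
Proof.
move=> OO'; elim: j f => [|j IH] f /=; first by move=> h x /OO'; exact: h.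
by move=> [df Df]; split=> [x /OO'/df//|v]; exact/IH/Df.
Qed.

Lemma smooth_upto_eq j O f g : open O -> (forall x, O x -> f x = g x) ->
  smooth_upto j O f -> smooth_upto j O g.
Proof.
move=> Oo; elim: j f g => [|j IH] f g fg /=.
  move=> cf x Ox; have fgx : \near x, f x = g x.
    by apply: (@filterS _ _ _ O _ fg); exact: open_nbhs_nbhs.
  move: (cf x Ox); rewrite /prop_for /continuous_at -(fg x Ox) => h.
  by apply: cvg_trans h; exact: near_eq_cvg fgx.
have nfg x : O x -> \near x, f x = g x.
  by move=> Ox; apply: (@filterS _ _ _ O _ fg); exact: open_nbhs_nbhs.
move=> [df Df]; split=> [x Ox|v].
  exact: near_eq_differentiable (nfg _ Ox) (df _ Ox).
by apply: IH (Df v) => x /nfg /near_eq_derive.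
Qed.

Lemma smooth_uptoW j O f : smooth_upto j.+1 O f -> smooth_upto j O f.
Proof.
elim: j f => [|j IH] f /= [df Df].
  by move=> x Ox; apply: differentiable_continuous; exact: df.
by split=> // v; apply: IH; exact: Df.
Qed.

Lemma smooth_upto_cst j O (w : W) : smooth_upto j O (cst w).
Proof.
elim: j w => [|j IH] w /=; first by move=> x _; exact: cst_continuous.
split=> [x _|v]; first exact: differentiable_cst.
have -> : 'D_v (cst w : 'rV[R]_n -> W) = cst 0.
  by apply/funext => x; rewrite derive_cst.
exact: IH.
Qed.

Lemma smooth_uptoD j O f g : open O ->
  smooth_upto j O f -> smooth_upto j O g -> smooth_upto j O (f + g).
Proof.
move=> Oo; elim: j f g => [|j IH] f g /=.
  by move=> cf cg x Ox; apply: continuousD; [exact: cf|exact: cg].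
move=> [df Df] [dg Dg]; split=> [x Ox|v].
  by apply: differentiableD; [exact: df|exact: dg].
apply: smooth_upto_eq Oo _ (IH _ _ (Df v) (Dg v)) => // x Ox.
by rewrite deriveD//; apply: diff_derivable; [exact: df|exact: dg].
Qed.

End generic.

(** The differential of a continuous linear map is itself, so that directional
derivatives commute with it and the induction does not leave the statement. *)
Lemma smooth_upto_linear n (W W' : normedModType R) (L : {linear W -> W'}) j
    (O : set 'rV[R]_n) (f : 'rV[R]_n -> W) :
  continuous L -> open O -> smooth_upto j O f -> smooth_upto j O (L \o f).
Proof.
move=> cL Oo; elim: j f => [|j IH] f /=.
  by move=> cf x Ox; apply: continuous_comp; [exact: cf|exact: cL].
move=> [df Df]; have dL y : differentiable L y.
  exact: linear_differentiable.
split=> [x Ox|v].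
  by apply: differentiable_comp => //; exact: df.
apply: (smooth_upto_eq Oo _ (IH _ (Df v))) => x Ox /=.
have dfx := df x Ox.
rewrite !deriveE//; last exact: differentiable_comp.
by rewrite (diff_comp dfx (dL _)) /= diff_lin.
Qed.

Lemma smooth_uptoM n j (O : set 'rV[R]_n) (f g : 'rV[R]_n -> R) : open O ->
  smooth_upto j O f -> smooth_upto j O g -> smooth_upto j O (f * g).
Proof.
move=> Oo; elim: j f g => [|j IH] f g.
  move=> /= cf cg x Ox; apply: continuousM; [exact: cf|exact: cg].
move=> /[dup] /smooth_uptoW f' [df Df] /[dup] /smooth_uptoW g' [dg Dg].
split=> [x Ox|v].
  by apply: differentiableM; [exact: df|exact: dg].
have := smooth_uptoD Oo (IH _ _ f' (Dg v)) (IH _ _ g' (Df v)).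
apply: (smooth_upto_eq Oo) => x Ox.
by rewrite deriveM//; apply: diff_derivable; [exact: df|exact: dg].
Qed.

Lemma smooth_upto_sum n (W : normedModType R) j (O : set 'rV[R]_n) I (r : seq I)
    (F : I -> 'rV[R]_n -> W) : open O ->
  (forall i, smooth_upto j O (F i)) -> smooth_upto j O (\sum_(i <- r) F i).
Proof.
move=> Oo h; elim/big_ind : _ => //; first exact: smooth_upto_cst.
by move=> f g; exact: smooth_uptoD.
Qed.

Lemma smooth_upto_coord n p j (O : set 'rV[R]_n) (f : 'rV[R]_n -> 'rV[R]_p) :
  open O -> smooth_upto j O f <-> forall i, smooth_upto j O (fun x => f x 0 i).
Proof.
move=> Oo; split=> [sf i|sf].
  have lin : linear (fun v : 'rV[R]_p => v 0 i : R^o) by move=> a u v; rewrite !mxE.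
  pose cM := GRing.isLinear.Build _ _ _ _ _ lin.
  pose c : {linear 'rV[R]_p -> R^o} := HB.pack (fun v : 'rV[R]_p => v 0 i) cM.
  have cc : continuous c by move=> v; exact: coord_continuous.
  exact: (smooth_upto_linear cc Oo sf).
have -> : f = \sum_i (fun x => f x 0 i *: delta_mx 0 i).
  by apply/funext => x; rewrite fct_sumE; exact: row_sum_delta.
apply: smooth_upto_sum => // i.
have lin : linear (fun c : R^o => c *: (delta_mx 0 i : 'rV[R]_p)).
  by move=> a u v; rewrite scalerDl scalerA.
pose cM := GRing.isLinear.Build _ _ _ _ _ lin.
pose c : {linear R^o -> 'rV[R]_p} := HB.pack (fun c : R^o => c *: _) cM.
have cc : continuous c by exact: scalel_continuous.
exact: (smooth_upto_linear cc Oo (sf i)).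
Qed.

(** By the chain rule, ['D_v (g \o f)] is the sum over [i] of the [i]-th coordinate
of ['D_v f] times [('D_(e_i) g) \o f]. Both factors involve one derivative less,
and only products of real functions occur. *)
Lemma smooth_upto_comp n p j (O : set 'rV[R]_n) (O' : set 'rV[R]_p)
    (f : 'rV[R]_n -> 'rV[R]_p) (g : 'rV[R]_p -> R) :
  open O -> open O' -> (forall x, O x -> O' (f x)) ->
  smooth_upto j O f -> smooth_upto j O' g -> smooth_upto j O (g \o f).
Proof.
move=> Oo Oo' fO; elim: j f g fO => [|j IH] f g fO.
  move=> /= cf cg x Ox; apply: continuous_comp; first exact: cf.
  by apply: cg; exact: fO.
move=> /[dup] /smooth_uptoW f' [df Df] [dg Dg].
split=> [x Ox|v].
  by apply: differentiable_comp; [exact: df|apply: dg; exact: fO].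
have : smooth_upto j O
    (\sum_i ((fun x => 'D_v f x 0 i) * ('D_(delta_mx 0 i) g \o f))).
  apply: smooth_upto_sum => // i; apply: smooth_uptoM => //.
    by move: i; apply/smooth_upto_coord => //; exact: Df.
  by apply: IH => //; exact: Dg.
apply: (smooth_upto_eq Oo) => x Ox.
have dfx := df x Ox; have dgx := dg _ (fO _ Ox).
rewrite fct_sumE deriveE; last exact: differentiable_comp.
rewrite (diff_comp dfx dgx) /= -(deriveE _ dfx).
rewrite [in RHS](row_sum_delta ('D_v f x)) linear_sum; apply: eq_bigr => i _.
by rewrite linearZ /= -deriveE.
Qed.

End calculus.

(** * Smooth bump functions *)

Section bump.
Context {R : realType}.

(** The functions [t ^ (- n) exp (- 1 / t)], extended by [0] to [t <= 0], are stable
under differentiation up to linear combinations; considering all [n] at once is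
what makes the induction on the order of smoothness work. *)
Definition flat (n : nat) (t : R) : R :=
  if 0 < t then t^-1 ^+ n * expR (- t^-1) else 0.

Lemma flat_le0 n t : t <= 0 -> flat n t = 0.
Proof. by rewrite /flat leNgt; case: (0 < t). Qed.

Lemma flat_gt0 n t : 0 < t -> flat n t = t^-1 ^+ n * expR (- t^-1).
Proof. by rewrite /flat => ->. Qed.

Lemma flat_ge0 n t : 0 <= flat n t.
Proof.
have [t0|t0] := ltP 0 t; last by rewrite flat_le0.
by rewrite flat_gt0// mulr_ge0 ?expR_ge0// exprn_ge0 ?invr_ge0 ?ltW.
Qed.

(** The exponential series gives [(1 / t) ^ (n + 2) <= (n + 2)! exp (1 / t)]. The
square on the right-hand side is what makes [flat n] differentiable at [0], with
derivative [0]. *)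
Lemma flat_le_sqr n t : flat n t <= n.+2`!%:R * t ^+ 2.
Proof.
have [t0|t0] := ltP 0 t; last first.
  by rewrite flat_le0// mulr_ge0// sqr_ge0.
have it0 : 0 < t^-1 by rewrite invr_gt0.
rewrite flat_gt0// expRN ler_pdivrMr ?expR_gt0//.
have f0 : (0 : R) < n.+2`!%:R by rewrite ltr0n fact_gt0.
have := expR_ge1Dxn n.+1 (ltW it0).
rewrite -(ler_pM2l f0) mulrDr mulr1 mulrC divfK ?gt_eqF// => h.
have {}h : t^-1 ^+ n.+2 <= n.+2`!%:R * expR t^-1.
  by apply: le_trans h; rewrite lerDr ltW.
have -> : t^-1 ^+ n = t^-1 ^+ n.+2 * t ^+ 2.
  by rewrite -addn2 exprD -mulrA -exprMn mulVf ?gt_eqF// expr1n mulr1.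
by rewrite [leRHS]mulrAC ler_pM2r ?exprn_gt0.
Qed.

Lemma is_derive_flat n (t : R) :
  is_derive t (1 : R) (flat n) (- n%:R * flat n.+1 t + flat n.+2 t).
Proof.
have [t0|t0|->] := ltgtP t 0.
- rewrite !flat_le0 ?ltW// mulr0 addr0.
  apply: near_eq_is_derive (is_derive_cst (0 : R) t (1 : R)).
  by near=> s; rewrite flat_le0// ltW//; near: s; exact: lt_nbhsl.
- have tn0 : t != 0 by rewrite gt_eqF.
  have dV : is_derive t (1 : R) (fun s : R => s^-1) (- t ^- 2).
    apply: is_derive_eq; first exact: is_deriveV.
    by rewrite /GRing.scale/= mulr1.
  have dE : is_derive t (1 : R) (fun s : R => s^-1 ^+ n * expR (- s^-1))
      (- n%:R * flat n.+1 t + flat n.+2 t).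
    have dX := is_deriveX n dV.
    have dN := is_deriveN dV.
    have dexp := @is_derive1_comp _ expR (- (fun s : R => s^-1)) t _ _
      (is_derive_expR (- t^-1)) dN.
    have := is_deriveM dX dexp; rewrite !flat_gt0//.
    have -> : (fun s : R => s^-1) ^+ n * (expR \o (- (fun s : R => s^-1))) =
        (fun s : R => s^-1 ^+ n * expR (- s^-1)).
      by apply/funext => s; rewrite !fctE.
    move=> H; apply: is_derive_eq H _.
    rewrite !fctE /GRing.scale/= -exprVn.
    set E := expR _; set a := t^-1; case: n {dX} => [|n] /=.
      by rewrite !expr0; ring.
    by rewrite !exprS; ring.
  apply: near_eq_is_derive dE.
  by near=> s; rewrite flat_gt0//; near: s; exact: lt_nbhsr.
- rewrite !flat_le0// mulr0 addr0.
  have c : (fun h => h^-1 *: (flat n (h *: 1 + 0) - flat n 0)) @ 0^' --> (0 : R).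
    apply/cvgrPdist_le => e e0.
    have C0 : (0 : R) < n.+2`!%:R by rewrite ltr0n fact_gt0.
    near=> h.
    have h0 : h != 0 by near: h; exact: nbhs_dnbhs_neq.
    rewrite sub0r normrN (flat_le0 _ (lexx 0)) subr0 addr0 /GRing.scale/= mulr1.
    rewrite normrM normfV ler_pdivrMl ?normr_gt0// ger0_norm ?flat_ge0//.
    apply: le_trans (flat_le_sqr _ _) _.
    rewrite -real_normK ?num_real// expr2 mulrCA ler_pM2l ?normr_gt0//.
    rewrite -ler_pdivlMl// mulrC.
    near: h; apply: dnbhs0_le; exact: divr_gt0.
  by split; [exact: cvgP c|exact: cvg_lim c].
Unshelve. all: by end_near. Qed.

(** The chain rule and [is_derive_flat] express the derivative of [flat n \o u] in
terms of [flat n.+1 \o u] and [flat n.+2 \o u]. *)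
Lemma smooth_upto_flat m j n (O : set 'rV[R]_m) (u : 'rV[R]_m -> R) :
  open O -> smooth_upto j O u -> smooth_upto j O (flat n \o u).
Proof.
move=> Oo; have dfl k t : differentiable (flat k) t.
  by apply/derivable1_diffP; have [] := is_derive_flat k t.
elim: j n u => [|j IH] n u.
  move=> /= cu x Ox; apply: continuous_comp; first exact: cu.
  exact: differentiable_continuous.
move=> /[dup] /smooth_uptoW u' [du Du].
split=> [x Ox|v]; first by apply: differentiable_comp => //; exact: du.
have := smooth_uptoM Oo (Du v) (smooth_uptoD Oo
  (smooth_uptoM Oo (smooth_upto_cst j O (- n%:R : R)) (IH n.+1 _ u'))
  (IH n.+2 _ u')).
apply: (smooth_upto_eq Oo) => x Ox; have dux := du x Ox.
rewrite [RHS]deriveE; last exact: differentiable_comp.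
rewrite (diff_comp dux (dfl n (u x))) /= -(deriveE _ dux).
rewrite -[X in _ = 'd _ _ X]mulr1 [RHS]linearZ /= -deriveE//.
by have [_ ->] := is_derive_flat n (u x); rewrite !fctE.
Qed.

Lemma flat_homo (s t : R) : s <= t -> flat 0 s <= flat 0 t.
Proof.
move=> st; have [s0|s0] := ltP 0 s; last by rewrite flat_le0// flat_ge0.
have t0 := lt_le_trans s0 st.
by rewrite !flat_gt0// !expr0 !mul1r ler_expR lerN2 lef_pV2.
Qed.

(** With [e = flat 0], this is [e (1 - e t / e 1) / e 1]. For [t <= 0] the inner [e t]
vanishes and the value is [1]; for [t >= 1] the argument of the outer [e] is
nonpositive and the value is [0]. Nesting [e] in itself in this way avoids
dividing by a function. *)
Definition smooth_step (t : R) : R :=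
  flat 0 (1 - (flat 0 1)^-1 * flat 0 t) * (flat 0 1)^-1.

Lemma flat1_gt0 : 0 < flat 0 1.
Proof. by rewrite flat_gt0// expr0 mul1r expR_gt0. Qed.

Lemma smooth_step_le0 t : t <= 0 -> smooth_step t = 1.
Proof.
move=> t0; rewrite /smooth_step (flat_le0 _ t0) mulr0 subr0 divff//.
by rewrite gt_eqF ?flat1_gt0.
Qed.

Lemma smooth_step_ge1 t : 1 <= t -> smooth_step t = 0.
Proof.
move=> t1; rewrite /smooth_step [X in X * _]flat_le0 ?mul0r// subr_le0.
by rewrite mulrC ler_pdivlMr ?flat1_gt0// mul1r flat_homo.
Qed.

Lemma smooth_step_itv t : 0 <= smooth_step t <= 1.
Proof.
have i0 : 0 <= (flat 0 1)^-1 by rewrite invr_ge0 flat_ge0.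
apply/andP; split; first by rewrite mulr_ge0 ?flat_ge0.
rewrite /smooth_step ler_pdivrMr ?flat1_gt0// mul1r flat_homo// gerBl.
by rewrite mulr_ge0 ?flat_ge0.
Qed.

Lemma smooth_upto_step m j (O : set 'rV[R]_m) (u : 'rV[R]_m -> R) :
  open O -> smooth_upto j O u -> smooth_upto j O (smooth_step \o u).
Proof.
move=> Oo su.
have := smooth_uptoM Oo (smooth_upto_flat 0 Oo (smooth_uptoD Oo
  (smooth_upto_cst j O (1 : R)) (smooth_uptoM Oo (smooth_upto_cst j O (- (flat 0 1)^-1 : R))
     (smooth_upto_flat 0 Oo su)))) (smooth_upto_cst j O ((flat 0 1)^-1 : R)).
apply: (smooth_upto_eq Oo) => x Ox.
by rewrite !fctE /smooth_step/= mulNr.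
Qed.

(** [smooth_step] is applied to [2 q / r ^ 2 - 1], where [q] is the squared Euclidean
distance to [p]: this is negative near [p], and at least [1] where some
coordinate of [x - p] is at least [r] in absolute value, since then [q >= r ^ 2]. *)
Lemma exists_bump m (p : 'rV[R]_m) (r : R) : 0 < r ->
  exists b : 'rV[R]_m -> R, [/\ forall j, smooth_upto j setT b,
    forall x, 0 <= b x <= 1, forall x, r <= `|x - p| -> b x = 0 &
    \forall x \near p, b x = 1].
Proof.
move=> r0.
have r20 : 0 < r ^+ 2 by rewrite exprn_gt0.
pose s (i : 'I_m) := (fun x : 'rV[R]_m => x 0 i) + cst (- p 0 i).
pose q := \sum_i (s i * s i).
have qE x : q x = \sum_i (x 0 i - p 0 i) ^+ 2.
  by rewrite /q fct_sumE; apply: eq_bigr => i _; rewrite expr2.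
have oT : open (setT : set 'rV[R]_m) by exact: openT.
have sid j : smooth_upto j setT (id : 'rV[R]_m -> 'rV[R]_m).
  elim: j => [|[|j] _] /=; first by move=> x _; exact: cvg_id.
  - split=> // v x _; rewrite (_ : 'D_v _ = cst v); first exact: cst_continuous.
    by apply/funext => y; exact: derive_id.
  - split=> // v; rewrite (_ : 'D_v _ = cst v); first exact: smooth_upto_cst j.+1 _ v.
    by apply/funext => y; exact: derive_id.
have sq j : smooth_upto j setT q.
  apply: smooth_upto_sum => // i; apply: smooth_uptoM => //;
    apply: smooth_uptoD => //; try exact: smooth_upto_cst;
    by move: i; apply/smooth_upto_coord.
pose u := cst (2 / r ^+ 2) * q + cst (- 1).
exists (smooth_step \o u); split=> [j|x|x xp|].
- apply: smooth_upto_step => //; apply: smooth_uptoD => //.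
    by apply: smooth_uptoM => //; exact: smooth_upto_cst.
  exact: smooth_upto_cst.
- exact: smooth_step_itv.
- apply: smooth_step_ge1.
  suff : r ^+ 2 <= q x.
    move=> h; rewrite /u !fctE/= lerBrDr -ler_pdivrMl ?divr_gt0//.
    by rewrite invf_div (_ : _ * _ = r ^+ 2)//; field.
  have [i ri] : exists i, r <= `|x 0 i - p 0 i|.
    apply: contrapT => /forallNP h; move: xp; apply/negP; rewrite -ltNge.
    rewrite /Num.norm/= mx_normrE; apply/bigmax_ltP; split=> // -[a i] _ /=.
    by rewrite ord1 !mxE ltNge; apply/negP; exact: h.
  rewrite qE (bigD1 i)//=; apply: (@le_trans _ _ ((x 0 i - p 0 i) ^+ 2)).
    rewrite -[leRHS]real_normK ?num_real// ler_pXn2r// nnegrE ?ltW//.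
  by rewrite lerDl sumr_ge0// => k _; exact: sqr_ge0.
- have q0 : q p = 0 by rewrite qE big1// => i _; rewrite subrr expr0n.
  have : q @ p --> 0 by rewrite -[X in _ --> X]q0; exact: (sq 0%N).
  move=> /cvgrPdist_lt /(_ (r ^+ 2 / 2)); rewrite divr_gt0// => /(_ isT).
  apply: filterS => x; rewrite sub0r normrN => /(le_lt_trans (ler_norm _)) qx.
  apply: smooth_step_le0; rewrite /u !fctE/= subr_le0.
  by rewrite -ler_pdivlMl ?divr_gt0// mulr1 invf_div ltW.
Qed.

End bump.

(** * Operations on functions of class [C^k] *)

Section Ck_calculus.
Context {R : realType}.
Implicit Types (k : option nat) (m n p : nat).

(** A uniform form of the finite and the infinite order, which transfers the
properties of [smooth_upto] without distinguishing the two. *)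
Lemma Ck_openP k m n (O : set 'rV[R]_m) (f : 'rV[R]_m -> 'rV[R]_n) :
  Ck_open k O f <->
  forall j, (if k is Some i then i = j else True) -> smooth_upto j O f.
Proof.
case: k => [i|] /=; split.
- by move=> h j <-; exact/CfinE.
- by move=> /(_ i erefl) /CfinE.
- by move=> h j _; exact/CfinE.
- by move=> h j; exact/CfinE/h.
Qed.

Lemma Ck_open_subset k m n (O O' : set 'rV[R]_m) (f : 'rV[R]_m -> 'rV[R]_n) :
  O' `<=` O -> Ck_open k O f -> Ck_open k O' f.
Proof.
move=> OO' /Ck_openP h; apply/Ck_openP => j kj.
exact: smooth_upto_subset OO' (h j kj).
Qed.

Lemma Ck_open_continuous k m n (O : set 'rV[R]_m) (f : 'rV[R]_m -> 'rV[R]_n) x :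
  Ck_open k O f -> O x -> {for x, continuous f}.
Proof.
move=> /Ck_openP h Ox.
have [j sj] : exists j, smooth_upto j O f.
  by case: k h => [i|] h; [exists i; exact: h|exists 0%N; exact: h].
elim: j sj => [|j IH]; first exact.
by move=> /smooth_uptoW.
Qed.

Lemma Ck_open_comp k m n p (O : set 'rV[R]_m) (O' : set 'rV[R]_n)
    (f : 'rV[R]_m -> 'rV[R]_n) (g : 'rV[R]_n -> 'rV[R]_p) :
  open O -> open O' -> (forall x, O x -> O' (f x)) ->
  Ck_open k O f -> Ck_open k O' g -> Ck_open k O (g \o f).
Proof.
move=> Oo Oo' fO /Ck_openP sf /Ck_openP sg; apply/Ck_openP => j kj.
apply/smooth_upto_coord => // i.
apply: (@smooth_upto_comp _ _ _ _ _ _ f (fun y => g y 0 i) Oo Oo' fO (sf j kj)).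
by move: i; apply/smooth_upto_coord => //; exact: sg.
Qed.

Lemma Ck_open_cst k m n (O : set 'rV[R]_m) (w : 'rV[R]_n) :
  Ck_open k O (cst w).
Proof. by apply/Ck_openP => j _; exact: smooth_upto_cst. Qed.

Definition blend (T : Type) n (b : T -> 'rV[R]_1) (f g : T -> 'rV[R]_n) (x : T) :=
  (1 - b x 0 0) *: f x + b x 0 0 *: g x.

Lemma Ck_open_blend k m n (O : set 'rV[R]_m) (b : 'rV[R]_m -> 'rV[R]_1)
    (f g : 'rV[R]_m -> 'rV[R]_n) : open O ->
  Ck_open k O b -> Ck_open k O f -> Ck_open k O g -> Ck_open k O (blend b f g).
Proof.
move=> Oo /Ck_openP sb /Ck_openP sf /Ck_openP sg; apply/Ck_openP => j kj.
have crd q (h : 'rV[R]_m -> 'rV[R]_q) i :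
    smooth_upto j O h -> smooth_upto j O (fun x => h x 0 i).
  by move=> sh; move: i; apply/smooth_upto_coord.
have b' := crd _ _ 0 (sb j kj).
apply/smooth_upto_coord => // i.
have := smooth_uptoD Oo (smooth_uptoM Oo (smooth_uptoD Oo
   (smooth_upto_cst j O (1 : R)) (smooth_uptoM Oo (smooth_upto_cst j O (-1 : R)) b'))
   (crd _ _ i (sf j kj))) (smooth_uptoM Oo b' (crd _ _ i (sg j kj))).
apply: (smooth_upto_eq Oo) => x Ox.
by rewrite !fctE /blend !mxE mulN1r.
Qed.

Lemma open_setI_preimage (V W : topologicalType) (O : set V) (O' : set W)
    (f : V -> W) : open O -> open O' ->
  (forall x, O x -> {for x, continuous f}) -> open (O `&` f @^-1` O').
Proof.
move=> Oo Oo' cf; rewrite openE => x [Ox O'x].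
apply: filterI; first exact: open_nbhs_nbhs.
by apply: (cf x Ox); exact: open_nbhs_nbhs.
Qed.

End Ck_calculus.

(** * Germs of smooth vector-valued functions on a manifold *)

Section smooth_at.
Context {R : realType} (k : option nat) (m : nat) (M : topologicalType)
  (A : set (chart R m M)).

(** [F] is, near [x], a [C^k] function of the coordinates of one chart of the atlas.
Asking for an extension [G] to an open subset of the whole space covers boundary
points at once. *)
Definition smooth_at p (F : M -> 'rV[R]_p) (x : M) : Prop :=
  exists c O (G : 'rV[R]_m -> 'rV[R]_p), [/\ A c, open O, Ck_open k O G &
    \forall y \near x,
      [/\ chart_dom c y, O (chart_map c y) & F y = G (chart_map c y)]].

Lemma smooth_at_eq p (F F' : M -> 'rV[R]_p) x :
  (\forall y \near x, F y = F' y) -> smooth_at F x -> smooth_at F' x.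
Proof.
move=> FF' [c [ O [G [Ac Oo sG H]]]]; exists c, O, G; split=> //.
by apply: filterS2 FF' H => y FF'y [dy Oy FG]; rewrite -FF'y.
Qed.

Lemma smooth_at_near p (F : M -> 'rV[R]_p) x :
  smooth_at F x -> \forall y \near x, smooth_at F y.
Proof.
move=> [c [ O [G [Ac Oo sG H]]]].
have := nbhs_interior H; apply: filterS => y Hy.
by exists c, O, G; split.
Qed.

Lemma smooth_at_post p q (F : M -> 'rV[R]_p) (T : 'rV[R]_p -> 'rV[R]_q) O x :
  open O -> Ck_open k O T -> (\forall y \near x, O (F y)) ->
  smooth_at F x -> smooth_at (T \o F) x.
Proof.
move=> Oo sT FO [c [ O1 [G [Ac O1o sG H]]]].
exists c, (O1 `&` G @^-1` O), (T \o G); split=> //.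
- by apply: open_setI_preimage => // y; exact: (Ck_open_continuous sG).
- apply: (@Ck_open_comp _ _ _ _ _ _ O) => //.
  + by apply: open_setI_preimage => // y; exact: (Ck_open_continuous sG).
  + by move=> y [].
  + by apply: Ck_open_subset sG => y [].
- apply: filterS2 FO H => y Oy [dy O1y FG]; split=> //=; last by rewrite FG.
  by split=> //=; rewrite -FG.
Qed.

Hypothesis hM : Ck_manifold k A.

Lemma dom_nbhs c x : A c -> chart_dom c x -> nbhs x (chart_dom c).
Proof.
move=> Ac dx; apply: open_nbhs_nbhs; split=> //.
exact: chart_dom_open (atlas_chart hM Ac).
Qed.

Lemma chart_map_continuous_at c x : A c -> chart_dom c x ->
  {for x, continuous (chart_map c)}.
Proof.
move=> Ac dx; have hc := atlas_chart hM Ac.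
have := chart_map_continuous hc.
rewrite continuous_open_subspace; last exact: chart_dom_open hc.
by apply; exact: mem_set.
Qed.

Lemma smooth_at_continuous p (F : M -> 'rV[R]_p) x :
  smooth_at F x -> {for x, continuous F}.
Proof.
move=> [c [ O [G [Ac Oo sG H]]]].
have [cx Ox FGx] := nbhs_singleton H.
have cG : {for x, continuous (G \o chart_map c)}.
  apply: continuous_comp; first exact: chart_map_continuous_at.
  exact: (Ck_open_continuous sG Ox).
rewrite /prop_for /continuous_at FGx; apply: cvg_trans cG.
by apply: near_eq_cvg; apply: filterS H => y [_ _ ->].
Qed.

Lemma smooth_at_cst p (w : 'rV[R]_p) x : smooth_at (cst w) x.
Proof.
have [c Ac dx] := atlas_cover hM x.
exists c, setT, (cst w); split=> //; [exact: openT|exact: Ck_open_cst|].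
by apply: filterS (dom_nbhs Ac dx).
Qed.

(** The extended transition map lets the coordinates of the given chart replace
those in which the smoothness of [F] is known. *)
Lemma smooth_at_chart p (F : M -> 'rV[R]_p) x c : A c -> chart_dom c x ->
  smooth_at F x -> exists O (G : 'rV[R]_m -> 'rV[R]_p),
    [/\ open O, Ck_open k O G & \forall y \near x,
      [/\ chart_dom c y, O (chart_map c y) & F y = G (chart_map c y)]].
Proof.
move=> Ac cx [d [ O [G [Ad Oo sG H]]]].
have [ O' [T [Oo' sub sT TE]]] := atlas_transition hM Ad Ac.
have oI : open (O' `&` T @^-1` O).
  by apply: open_setI_preimage => // y; exact: (Ck_open_continuous sT).
exists (O' `&` T @^-1` O), (G \o T); split=> //.
- apply: (@Ck_open_comp _ _ _ _ _ _ O) => //; first by move=> y [].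
  by apply: Ck_open_subset sT => y [].
- apply: filterS2 (dom_nbhs Ac cx) H => y cy [dy Oy FG].
  have im : (chart_map c @` (chart_dom d `&` chart_dom c)) (chart_map c y).
    by exists y.
  have Ty : T (chart_map c y) = chart_map d y.
    by rewrite TE//= (chart_mapK (atlas_chart hM Ac)).
  split=> //=; last by rewrite Ty.
  by split; [exact: sub|rewrite /= Ty].
Qed.

Lemma smooth_at_blend p (b : M -> 'rV[R]_1) (F F' : M -> 'rV[R]_p) x :
  smooth_at b x -> smooth_at F x -> smooth_at F' x -> smooth_at (blend b F F') x.
Proof.
have [c Ac cx] := atlas_cover hM x.
move=> /(smooth_at_chart Ac cx) [ O [G [Oo sG H]]].
move=> /(smooth_at_chart Ac cx) [ O1 [G1 [Oo1 sG1 H1]]].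
move=> /(smooth_at_chart Ac cx) [ O2 [G2 [Oo2 sG2 H2]]].
have oI : open (O `&` O1 `&` O2) by do ?apply: openI.
exists c, (O `&` O1 `&` O2), (blend G G1 G2); split=> //.
- apply: Ck_open_blend => //; [apply: Ck_open_subset sG|
    apply: Ck_open_subset sG1|apply: Ck_open_subset sG2]; by move=> y [[]].
- apply: filterS3 H H1 H2 => y [cy Oy bG] [_ O1y FG1] [_ O2y FG2].
  by split=> //; rewrite /blend bG FG1 FG2.
Qed.

End smooth_at.

(** * Charts, compact neighbourhoods and bump functions on a manifold *)

Section charts.
Context {R : realType} (k : option nat) (m : nat) (M : topologicalType)
  (A : set (chart R m M)) (hM : Ck_manifold k A).

Definition restrict_chart (c : chart R m M) (U : set M) : chart R m M :=
  Chart (chart_dom c `&` U) (chart_map c) (chart_inv c).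

Lemma chart_inv_continuous_at c x : A c -> chart_dom c x ->
  chart_inv c @ within (chart_img c) (nbhs (chart_map c x)) --> x.
Proof.
move=> Ac cx; have hc := atlas_chart hM Ac.
rewrite -{2}(chart_mapK hc cx).
have /subspace_continuousP := chart_inv_continuous hc.
by apply; exists x.
Qed.

Lemma Ck_on_subset p q (D D' : set 'rV[R]_p) (f : 'rV[R]_p -> 'rV[R]_q) :
  D' `<=` D -> Ck_on k D f -> Ck_on k D' f.
Proof.
move=> DD' [ O [g [Oo DO sg gE]]]; exists O, g; split=> //.
  exact: subset_trans DO.
by move=> x /DD'; exact: gE.
Qed.

Lemma restrict_chart_is_chart c U : A c -> open U ->
  is_chart (restrict_chart c U).
Proof.
move=> Ac Uo; have hc := atlas_chart hM Ac; split.
- by apply: openI => //; exact: chart_dom_open hc.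
- have [ O Oo imO] := chart_img_open hc.
  (* [U] is read in the image of the chart through the continuous inverse *)
  pose O' := [set y : 'rV[R]_m |
    \forall z \near y, chart_img c z -> U (chart_inv c z)].
  exists (O `&` O').
    apply: openI => //; rewrite openE => y O'y; exact: nbhs_interior.
  apply/seteqP; split=> y.
    move=> [x [cx Ux] <-].
    have : chart_img c (chart_map c x) by exists x.
    rewrite imO => -[Ox Hx]; split=> //; split=> //.
    have := chart_inv_continuous_at Ac cx.
    by move=> /(_ U); apply; exact: open_nbhs_nbhs.
  move=> [[Oy O'y] Hy].
  have : chart_img c y by rewrite imO.
  move=> [x cx xy]; exists x => //; split=> //.
  have := nbhs_singleton O'y.
  by rewrite -xy (chart_mapK hc)//; apply; exists x.
- by move=> x [cx _]; exact: (chart_mapK hc).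
- by apply: (continuous_subspaceW _ (chart_map_continuous hc)) => y [].
- apply: (continuous_subspaceW _ (chart_inv_continuous hc)).
  by move=> y [x [cx _] <-]; exists x.
Qed.

(** The transition maps of a restriction are restrictions of those of the chart, so
that maximality applies. *)
Lemma restrict_chart_atlas c U : A c -> open U -> A (restrict_chart c U).
Proof.
move=> Ac Uo; apply: (atlas_maximal hM); first exact: restrict_chart_is_chart.
move=> d Ad; split.
  apply: Ck_on_subset (atlas_transition hM Ac Ad).
  by move=> _ [x [[cx Ux] dx] <-]; exists x.
apply: Ck_on_subset (atlas_transition hM Ad Ac).
by move=> _ [x [dx [cx Ux]] <-]; exists x.
Qed.

(** The image of the chart restricted to [U] is the trace of an open set on the
half-space, and contains the trace of a small closed ball. *)
Lemma chart_shrink c (U : set M) (x : M) : A c -> chart_dom c x -> nbhs x U ->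
  exists2 r : R, 0 < r &
   forall v, @halfspace R m v -> `|v - chart_map c x| <= r ->
    exists y, [/\ chart_dom c y, U y & chart_map c y = v].
Proof.
move=> Ac cx Ux.
have [V [Vo Vx] VU] : exists2 V, open_nbhs x V & V `<=` U.
  by move: Ux; rewrite nbhsE.
have [ O Oo imO] := chart_img_open (restrict_chart_is_chart Ac Vo).
have Ox : O (chart_map c x).
  have : chart_img (restrict_chart c V) (chart_map c x) by exists x.
  by rewrite imO => -[].
have /nbhs_closedballP [r rO] : nbhs (chart_map c x) O by exact: open_nbhs_nbhs.
exists r%:num => // v Hv vr.
have : chart_img (restrict_chart c V) v.
  rewrite imO; split=> //; apply: rO.
  by rewrite closed_ballE//= /closed_ball_/= distrC.
by move=> [y [cy Vy] <-]; exists y; split=> //; exact: VU.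
Qed.

Lemma halfspace_closed n : closed (@halfspace R n).
Proof.
rewrite (_ : @halfspace R n = \bigcap_(i in [set i : 'I_n | nat_of_ord i = 0%N])
   [set x : 'rV[R]_n | 0 <= x ord0 i]).
  apply: closed_bigI => i _.
  apply: (@preimage_closed _ _ (fun x : 'rV[R]_n => x ord0 i) [set y : R | 0 <= y]).
    by move=> x _; exact: coord_continuous.
  exact: closed_ge.
by apply/seteqP; split=> x /= h i; exact: h.
Qed.

Lemma chart_halfspace c y : A c -> chart_dom c y -> @halfspace R m (chart_map c y).
Proof.
move=> Ac cy; have [ O _ imO] := chart_img_open (atlas_chart hM Ac).
have : chart_img c (chart_map c y) by exists y.
by rewrite imO => -[].
Qed.

Definition chart_ball (c : chart R m M) (x : M) (r : R) : set M :=
  [set y | chart_dom c y /\ `|chart_map c y - chart_map c x| <= r].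

(** It is the image, by the inverse of the chart, of the trace on the half-space of
a closed ball, which is compact because it is closed and bounded. *)
Lemma chart_ball_compact c x (r : R) : A c -> 0 < r ->
  (forall v, @halfspace R m v -> `|v - chart_map c x| <= r -> chart_img c v) ->
  compact (chart_ball c x r).
Proof.
move=> Ac r0 sub; have hc := atlas_chart hM Ac.
pose K := [set v | @halfspace R m v /\ `|v - chart_map c x| <= r].
have -> : chart_ball c x r = chart_inv c @` K.
  apply/seteqP; split=> y.
    move=> [cy yr]; exists (chart_map c y); last exact: chart_mapK.
    by split=> //; exact: chart_halfspace.
  move=> [v [Hv vr] <-]; have [z cz zv] := sub v Hv vr.
  by rewrite -zv (chart_mapK hc)//=; split=> //; rewrite zv.
apply: continuous_compact.
  apply: (continuous_subspaceW _ (chart_inv_continuous hc)).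
  by move=> v [Hv vr]; exact: sub.
have -> : K = @halfspace R m `&` closed_ball (chart_map c x) r.
  rewrite closed_ballE//; apply/seteqP; split=> v [Hv vr]; split=> //;
  by move: vr; rewrite /closed_ball_/= distrC.
apply: bounded_closed_compact.
  exists (`|chart_map c x| + r); split; first exact: num_real.
  move=> y ry v [_ /=]; rewrite closed_ballE// /closed_ball_/= distrC => vr.
  rewrite (le_trans _ (ltW ry))// -(subrK (chart_map c x) v) addrC.
  by rewrite (le_trans (ler_normD _ _))// lerD2l.
apply: closedI; [exact: halfspace_closed|exact: closed_ball_closed].
Qed.

Lemma exists_chart_ball c (U : set M) (x : M) :
  A c -> chart_dom c x -> nbhs x U ->
  exists r : R, [/\ 0 < r, compact (chart_ball c x r) & chart_ball c x r `<=` U].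
Proof.
move=> Ac cx Ux; have hc := atlas_chart hM Ac.
have [r r0 sub] := chart_shrink Ac cx Ux; exists r; split=> //.
  by apply: chart_ball_compact => // v Hv /(sub v Hv) [y [cy _ <-]]; exists y.
move=> y [cy yr]; have [z [cz Uz zy]] := sub _ (chart_halfspace Ac cy) yr.
by rewrite -(chart_mapK hc cy) -zy (chart_mapK hc).
Qed.

Lemma exists_compact_nbhs (U : set M) (x : M) : nbhs x U ->
  exists S, [/\ compact S, S `<=` U & nbhs x S].
Proof.
move=> Ux; have [c Ac cx] := atlas_cover hM x.
have [r [r0 cS SU]] := exists_chart_ball Ac cx Ux.
exists (chart_ball c x r); split=> //.
have := chart_map_continuous_at hM Ac cx.
move=> /cvgrPdist_le /(_ _ r0).
by apply: filterS2 (dom_nbhs hM Ac cx) => y cy yr; split=> //; rewrite distrC.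
Qed.

(** A bump function read in a chart, extended by [0]. The extension is smooth because
the support of the bump lies in a compact subset of the chart domain, which is
closed in [M] by separation. *)
Lemma exists_manifold_bump (U : set M) (x : M) : nbhs x U ->
  exists b : M -> 'rV[R]_1, [/\ forall y, smooth_at k A b y,
    forall y, 0 <= b y 0 0 <= 1, forall y, ~ U y -> b y = 0 &
    \forall y \near x, b y 0 0 = 1].
Proof.
move=> Ux; have [c Ac cx] := atlas_cover hM x.
have [r [r0 cS SU]] := exists_chart_ball Ac cx Ux.
have [b0 [sb0 b01 b00 b0x]] := exists_bump (chart_map c x) r0.
have Sc : closed (chart_ball c x r).
  by apply: compact_closed cS; exact: manifold_hausdorff hM.
pose b y : 'rV[R]_1 :=
  if pselect (chart_dom c y) then const_mx (b0 (chart_map c y)) else 0.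
have bS y : ~ chart_ball c x r y -> b y = 0.
  rewrite /b; case: pselect => // cy nS; apply/rowP => i; rewrite !mxE b00//.
  by rewrite leNgt; apply/negP => /ltW ?; exact: nS.
exists b; split=> [y|y|y nU|].
- have [cy|ncy] := pselect (chart_dom c y).
    exists c, setT, (fun v => const_mx (b0 v)); split=> //; first exact: openT.
      apply/Ck_openP => j _; apply/smooth_upto_coord => [|i]; first exact: openT.
      apply: (smooth_upto_eq _ _ (sb0 j)); first exact: openT.
      by move=> v _; rewrite mxE.
    apply: filterS (dom_nbhs hM Ac cy) => z cz; split=> //.
    by rewrite /b; case: pselect.
  apply: smooth_at_eq (smooth_at_cst hM 0 y).
  have : nbhs y (~` chart_ball c x r).
    by apply: open_nbhs_nbhs; split; [exact: closed_openC|move=> [/ncy]].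
  by apply: filterS => z /bS ->.
- rewrite /b; case: pselect => [?|?]; rewrite mxE ?lexx ?ler01//; exact: b01.
- by apply: bS => /SU.
- have := chart_map_continuous_at hM Ac cx b0x.
  apply: filterS2 (dom_nbhs hM Ac cx) => y cy.
  by rewrite /b; case: pselect => // _ /= h; rewrite mxE.
Qed.

End charts.

(** * Germs of smooth maps between manifolds *)

Section smooth_map.
Context {R : realType} (k : option nat) (m n : nat) (M : topologicalType)
  (N : metricType R) (A : set (chart R m M)) (B : set (chart R n N)).

Definition smooth_map_at (f : M -> N) (x : M) : Prop :=
  exists d, [/\ B d, \forall y \near x, chart_dom d (f y) &
    smooth_at k A (chart_map d \o f) x].

Lemma smooth_map_at_eq (f g : M -> N) x :
  (\forall y \near x, f y = g y) -> smooth_map_at f x -> smooth_map_at g x.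
Proof.
move=> fg [d [Bd df sf]]; exists d; split=> //.
  by apply: filterS2 fg df => y ->.
by apply: smooth_at_eq sf; apply: filterS fg => y /= ->.
Qed.

Lemma smooth_map_at_near (f : M -> N) x :
  smooth_map_at f x -> \forall y \near x, smooth_map_at f y.
Proof.
move=> [d [Bd df sf]].
apply: filterS2 (nbhs_interior df) (smooth_at_near sf) => y dfy sfy.
by exists d.
Qed.

Hypotheses (hM : Ck_manifold k A) (hN : Ck_manifold k B).

(** The transition map between two charts of the target being [C^k], smoothness does
not depend on the chart in which the values of [f] are read. *)
Lemma smooth_map_at_chart (f : M -> N) x d : B d ->
  (\forall y \near x, chart_dom d (f y)) -> smooth_map_at f x ->
  smooth_at k A (chart_map d \o f) x.
Proof.
move=> Bd dfx [e [Be efx sf]].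
have [ O [T [Oo sub sT TE]]] := atlas_transition hN Bd Be.
have im y : chart_dom d y -> chart_dom e y ->
    (chart_map e @` (chart_dom d `&` chart_dom e)) (chart_map e y).
  by move=> dy ey; exists y.
apply: (@smooth_at_eq _ _ _ _ _ _ (T \o (chart_map e \o f))).
  apply: filterS2 dfx efx => y dy ey /=.
  by rewrite TE/= ?(chart_mapK (atlas_chart hN Be))//; exact: im.
apply: (smooth_at_post Oo sT _ sf).
by apply: filterS2 dfx efx => y dy ey; apply: sub; exact: im.
Qed.

(** Near [x], [f] is the composite of a chart, of a continuous function that extends
its expression in the charts, and of the inverse of a chart of [N]. *)
Lemma Ck_map_continuous (f : M -> N) : Ck_map k A B f -> continuous f.
Proof.
move=> hf x; have [c [d [[Ac Bd] cx dfx sub [ O [G [Oo imO sG GE]]]]]] := hf x.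
have hd := atlas_chart hN Bd; have hc := atlas_chart hM Ac.
have fE y : chart_dom c y -> chart_map d (f y) = G (chart_map c y).
  move=> cy; rewrite GE; last by exists y.
  by rewrite /= (chart_mapK hc).
have cdf : {for x, continuous (chart_map d \o f)}.
  have cG : {for x, continuous (G \o chart_map c)}.
    apply: continuous_comp; first exact: (chart_map_continuous_at hM).
    by apply: (Ck_open_continuous sG); apply: imO; exists x.
  rewrite /prop_for /continuous_at /= fE//; apply: cvg_trans cG.
  by apply: near_eq_cvg; apply: filterS (dom_nbhs hM Ac cx) => y /= /fE ->.
move=> U /(chart_inv_continuous_at hN Bd dfx) /cdf.
apply: filterS2 (dom_nbhs hM Ac cx) => y cy /=.
have dfy : chart_dom d (f y) by apply: sub; exists y.
by rewrite (chart_mapK hd)//; apply; exists (f y).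
Qed.

(** The germs give a neighbourhood [U] of [x] where all the required conditions hold;
the chart of [M] restricted to [U] is in the atlas and meets the definition. *)
Lemma smooth_map_at_Ck_map (f : M -> N) :
  (forall x, smooth_map_at f x) -> Ck_map k A B f.
Proof.
move=> sf x; have [d [Bd dfx [c [ O [G [Ac Oo sG H]]]]]] := sf x.
have : nbhs x [set y | chart_dom d (f y) /\ [/\ chart_dom c y,
    O (chart_map c y) & (chart_map d \o f) y = G (chart_map c y)]].
  by apply: filterI.
rewrite nbhsE => -[U [Uo Ux] UH].
exists (restrict_chart c U), d; split.
- by split=> //; exact: restrict_chart_atlas hM _ _ Ac Uo.
- by split=> //; have [_ []] := UH x Ux.
- by have [] := UH x Ux.
- by move=> _ [y [_ /UH[dfy _]] <-].
- exists O, G; split=> //; first by move=> _ [y [_ /UH[_ []]] _ Oy _ <-].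
  move=> _ [y [cy /UH[_ [_ _ fG]]] <-] /=.
  by rewrite (chart_mapK (atlas_chart hM Ac)).
Qed.

End smooth_map.

(** * Approximation of continuous maps *)

(** If [Q K] fails, the sets [X] such that [Q (K `\` X)] holds form a proper filter
containing [K]. It has a cluster point in [K], which contradicts [Q] on a
neighbourhood of that point. *)
Lemma compact_induction (T : topologicalType) (K : set T) (Q : set T -> Prop) :
  compact K -> Q set0 -> (forall X Y, X `<=` Y -> Q Y -> Q X) ->
  (forall X Y, Q X -> Q Y -> Q (X `|` Y)) ->
  (forall x, K x -> exists2 U, nbhs x U & Q U) -> Q K.
Proof.
move=> cK Q0 Qsub QU Qloc; apply: contrapT => nQK.
pose F : set_system T := [set X | Q (K `\` X)].
have FF : ProperFilter F.
  apply: Build_ProperFilter_ex; last first.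
    split; rewrite /F/=.
    - by rewrite setDT.
    - by move=> X Y QX QY /=; rewrite setDIr; exact: QU.
    - by move=> X Y XY; apply: Qsub; exact: setDS.
  move=> X QX; apply: contrapT => /forallNP X0; apply: nQK.
  by apply: Qsub QX => x Kx; split=> // /X0.
have FK : F K by rewrite /F/= setDv.
have [x [Kx clx]] := cK F FF FK.
have [U Ux QUU] := Qloc x Kx.
have FU : F (~` U) by apply: Qsub QUU => y [_] /contrapT.
by have [y []] := clx _ _ FU Ux.
Qed.

(** The members of a countable base that are contained in some compact set cover the
space by local compactness; each of them is enlarged to a compact set. *)
Lemma compact_sequence_cover (M : topologicalType) :
  @second_countable M ->
  (forall x : M, exists2 S, compact S & nbhs x S) ->
  exists C : nat -> set M, (forall i, compact (C i)) /\
    forall x : M, exists i, nbhs x (C i).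
Proof.
move=> [Bs cB [Bo Bb]] loc.
have /countable_injP [h hinj] := cB.
pose P i (K : set M) := compact K /\ forall b, Bs b -> h b = i ->
  (exists2 K', compact K' & b `<=` K') -> b `<=` K.
have /choice [C hC] : forall i, exists K, P i K.
  move=> i; have [[b [Bsb hb [K cK bK]]]|nb] := pselect (exists b,
      [/\ Bs b, h b = i & exists2 K', compact K' & b `<=` K']).
    exists K; split=> // b' Bsb' hb' _.
    by rewrite (_ : b' = b)//; apply: hinj; rewrite ?inE// hb hb'.
  exists set0; split; first exact: compact0.
  by move=> b Bsb hb hK; exfalso; apply: nb; exists b.
exists C; split=> [i|x]; first by have [] := hC i.
have [S cS Sx] := loc x.
have [b [Bsb bx] bS] := Bb x S Sx.
exists (h b); have [_ /(_ b Bsb erefl)] := hC (h b).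
move=> /(_ (ex_intro2 _ _ S cS bS)) bC.
by apply: filterS bC _; apply: open_nbhs_nbhs; split=> //; exact: Bo.
Qed.

Lemma halfspace_blend (R : realType) p (t : R) (u v : 'rV[R]_p) : 0 <= t <= 1 ->
  @halfspace R p u -> @halfspace R p v ->
  @halfspace R p ((1 - t) *: u + t *: v).
Proof.
move=> /andP[t0 t1] hu hv i i0; rewrite !mxE.
by rewrite addr_ge0// mulr_ge0// ?subr_ge0//; [exact: hu|exact: hv].
Qed.

Section approximation.
Context {R : realType} (k : option nat) (m n : nat) (M : topologicalType)
  (N : metricType R) (A : set (chart R m M)) (B : set (chart R n N)).
Hypotheses (hM : Ck_manifold k A) (hN : Ck_manifold k B).

(** A uniform size for the moves made in a chart of [N]: on a compact set, values that
are close enough to those of [g], and in the half-space, come from points of [N]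
that are close to those of [g]. The radius exists locally, and a minimum of two
radii serves on a union. *)
Lemma uniform_chart_radius (g : M -> N) d (K : set M) (e : R) :
  continuous g -> B d -> compact K -> (forall z, K z -> chart_dom d (g z)) ->
  0 < e -> exists2 r : R, 0 < r & forall z v, K z -> @halfspace R n v ->
    `|v - chart_map d (g z)| < r ->
    chart_img d v /\ mdist (g z) (chart_inv d v) < e.
Proof.
move=> cg Bd cK Kd e0.
pose P (r : R) z := forall v, @halfspace R n v -> `|v - chart_map d (g z)| < r ->
    chart_img d v /\ mdist (g z) (chart_inv d v) < e.
suff [r r0 H] : exists2 r : R, 0 < r & forall z, K z -> K z -> P r z.
  by exists r => // z v Kz; exact: H.
apply: (compact_induction (Q := fun X => exists2 r : R, 0 < r &
   forall z, X z -> K z -> P r z) cK).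
- by exists 1.
- by move=> X Y XY [r r0 H]; exists r => // z /XY; exact: H.
- move=> X Y [r r0 H] [s s0 H']; exists (Num.min r s); first by rewrite lt_min r0.
  by move=> z [Xz|Yz] Kz v Hv; rewrite lt_min => /andP[vr vs];
    [apply: H|apply: H'].
move=> x Kx; have dx := Kd x Kx.
have e20 : 0 < e / 2 by rewrite divr_gt0.
have [r r0 sub] := chart_shrink hN Bd dx (nbhsx_ballx (g x) _ e20).
have r20 : 0 < r / 2 by rewrite divr_gt0.
have cdg : {for x, continuous (chart_map d \o g)}.
  by apply: continuous_comp; [exact: cg|exact: (chart_map_continuous_at hN)].
exists [set z | ball (g x) (e / 2) (g z) /\
    `|chart_map d (g x) - chart_map d (g z)| < r / 2].
  apply: filterI; first exact: (cg x _ (nbhsx_ballx (g x) _ e20)).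
  by move/cvgrPdist_lt : cdg => /(_ _ r20).
exists (r / 2) => // z [gz dz] Kz v Hv vz.
have [|y [dy Uy yv]] := sub v Hv.
  rewrite -(subrKA (chart_map d (g z))) (le_trans (ler_normD _ _))//.
  by rewrite [leRHS](splitr r) lerD// ltW// distrC.
rewrite -yv; split; first by exists y.
rewrite (chart_mapK (atlas_chart hN Bd))//.
have := ball_triangle (ball_sym gz) Uy.
by rewrite -splitr ballEmdist.
Qed.

(** The flattening argument. The property propagated by [compact_induction] is that
any admissible [h1] can be made smooth on [X] without losing admissibility or
smoothness elsewhere; admissible means continuous, unchanged off [L] and on [D],
and [r]-close to [h0] with values in the half-space. It holds near a point [p] by
blending [h1] with the constant [h0 p], using a bump supported where [h0] is
[r]-close to [h0 p]: both [h1 z] and [h0 p] then lie in the convex ball of radius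
[r] around [h0 z], for every [z] of that support. The comparison is always with
[h0], so the bound does not deteriorate when the number of flattenings grows. *)
Lemma flatten_on_compact (h0 : M -> 'rV[R]_n) (S T L D : set M) (r : R) :
  open S -> L `<=` S -> (forall z, S z -> {for z, continuous h0}) ->
  (forall z, S z -> @halfspace R n (h0 z)) -> 0 < r ->
  compact T -> T `<=` interior L -> closed D -> (forall z, T z -> ~ D z) ->
  exists h, [/\ forall z, S z -> {for z, continuous h},
    forall z, ~ L z \/ D z -> h z = h0 z,
    forall z, S z -> @halfspace R n (h z) /\ `|h z - h0 z| < r,
    forall z, smooth_at k A h0 z -> smooth_at k A h z &
    forall z, T z -> smooth_at k A h z].
Proof.
move=> So LS ch0 Hh0 r0 cT TL cD TD.
pose inv h := [/\ forall z, S z -> {for z, continuous h},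
    forall z, ~ L z \/ D z -> h z = h0 z &
    forall z, S z -> @halfspace R n (h z) /\ `|h z - h0 z| < r].
pose Q X := forall h1, inv h1 -> exists h2, [/\ inv h2,
  forall z, smooth_at k A h1 z -> smooth_at k A h2 z &
  forall z, X z -> smooth_at k A h2 z].
have inv0 : inv h0.
  by split=> // z Sz; split; [exact: Hh0|rewrite subrr normr0].
suff /(_ h0 inv0) [h [[ch Lh Hh] mono sT]] : Q T by exists h.
apply: compact_induction cT _ _ _ _.
- by move=> h1 ih1; exists h1.
- move=> X Y XY QY h1 /QY [h2 [ih2 mono sY]]; exists h2; split=> // z /XY.
  exact: sY.
- move=> X Y QX QY h1 /QX [h2 [/QY [h3 [ih3 mono3 sY]] mono2 sX]].
  exists h3; split=> // [z /mono2/mono3//|z [/sX/mono3//|/sY//]].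
move=> p Tp.
have Lp : nbhs p L := TL p Tp.
have Sp : S p by apply: LS; exact: nbhs_singleton Lp.
have nbhsU : nbhs p [set z | [/\ L z, ~ D z & `|h0 p - h0 z| < r]].
  have nDp : nbhs p (~` D).
    by apply: open_nbhs_nbhs; split; [exact: closed_openC|exact: TD].
  have /cvgrPdist_lt /(_ _ r0) := ch0 p Sp.
  by apply: filterS3 Lp nDp => z.
have [b [sb b01 b0 b1]] := exists_manifold_bump hM nbhsU.
exists (interior [set y | b y 0 0 = 1]); first exact: nbhs_interior b1.
move=> h1 [ch1 Lh1 Hh1]; exists (blend b h1 (cst (h0 p))).
have sh2 z : smooth_at k A h1 z -> smooth_at k A (blend b h1 (cst (h0 p))) z.
  by move=> s1; apply: smooth_at_blend => //; exact: smooth_at_cst.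
split=> //; last first.
  move=> z; rewrite /interior /= => bz.
  apply: smooth_at_eq (smooth_at_cst hM (h0 p) z).
  by apply: filterS bz => y /= by1; rewrite /blend by1 subrr scale0r add0r scale1r.
split.
- move=> z Sz; have cb := smooth_at_continuous hM (sb z).
  have cb0 : {for z, continuous (fun y => b y 0 0)}.
    apply: (@continuous_comp _ _ _ b (fun v : 'rV[R]_1 => v 0 0) z cb).
    exact: coord_continuous.
  apply: continuousD; apply: continuousZ => //.
  + by apply: continuousB => //; exact: cst_continuous.
  + exact: ch1.
  + exact: cst_continuous.
- move=> z LDz; rewrite /blend b0; last by move=> [Lz nDz _]; case: LDz.
  by rewrite mxE subr0 scale1r scale0r addr0 Lh1.
- move=> z Sz; have [Hz rz] := Hh1 z Sz; split.
    by apply: halfspace_blend => //; exact: Hh0.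
  have [[Lz nDz hz]|nU] := pselect [/\ L z, ~ D z & `|h0 p - h0 z| < r]; last first.
    by rewrite /blend (b0 _ nU) mxE subr0 scale1r scale0r addr0.
  have /andP[t0 t1] := b01 z; rewrite /blend; set t := b z 0 0 in t0 t1 *.
  (* convexity of the ball of radius [r] around [h0 z] *)
  have -> : (1 - t) *: h1 z + t *: h0 p - h0 z =
      (1 - t) *: (h1 z - h0 z) + t *: (h0 p - h0 z).
    by rewrite !scalerBr addrACA -opprD -scalerDl subrK scale1r.
  rewrite (le_lt_trans (ler_normD _ _))// !normrZ ger0_norm ?subr_ge0//.
  rewrite [`|t|]ger0_norm//.
  have [->|tn1] := eqVneq t 1; first by rewrite subrr mul0r add0r mul1r.
  have t1' : 0 < 1 - t by rewrite subr_gt0 lt_neqAle tn1.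
  have -> : r = (1 - t) * r + t * r by ring.
  by rewrite ltr_leD// ?ltr_pM2l// ler_wpM2l// ltW.
Qed.

(** [flatten_on_compact] is applied to the expression of [g] in the chart [d], only
at the points of [T] where [g] is not yet smooth. These form a compact set that
is disjoint from [D], because germs of smooth maps form an open condition and [g]
is smooth along [D]. The set [L] contains the supports of all modifications: the
new map and [g] agree near the points outside [S], where the chart cannot be
used. *)
Lemma smooth_in_chart (g : M -> N) d (S L T D : set M) (e : R) :
  continuous g -> B d -> open S -> compact L -> L `<=` S ->
  (forall z, S z -> chart_dom d (g z)) -> compact T -> T `<=` interior L ->
  closed D -> (forall z, D z -> smooth_map_at k A B g z) -> 0 < e ->
  exists g' : M -> N, [/\ continuous g', forall z, mdist (g z) (g' z) < e,
    forall z, D z -> g' z = g z,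
    forall z, smooth_map_at k A B g z -> smooth_map_at k A B g' z &
    forall z, T z -> smooth_map_at k A B g' z].
Proof.
move=> cg Bd So cL LS Sd cT TL cD sD e0.
have hd := atlas_chart hN Bd.
have clL : closed L by apply: compact_closed cL; exact: manifold_hausdorff hM.
pose h0 := chart_map d \o g.
have [r r0 rP] := uniform_chart_radius cg Bd cL (fun z Lz => Sd z (LS z Lz)) e0.
pose W := [set z | smooth_map_at k A B g z].
have Wo : open W by rewrite openE => z; exact: smooth_map_at_near.
have ch0 z : S z -> {for z, continuous h0}.
  move=> /Sd dz; apply: continuous_comp; first exact: cg.
  exact: (chart_map_continuous_at hN).
have Hh0 z : S z -> @halfspace R n (h0 z).
  by move=> /Sd dz; exact: (chart_halfspace hN).
have cTW : compact (T `&` ~` W) by apply: compact_closedI => //; exact: open_closedC.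
have TWL : T `&` ~` W `<=` interior L by move=> z [/TL].
have TWD z : (T `&` ~` W) z -> ~ D z by move=> [_ nW] /sD.
have [h [ch hE Hh mono sT]] :=
  flatten_on_compact So LS ch0 Hh0 r0 cTW TWL cD TWD.
pose g' z := if pselect (S z) then chart_inv d (h z) else g z.
have nSg z : ~ L z -> g' z = g z.
  move=> nL; rewrite /g'; case: pselect => // Sz.
  by rewrite hE; [rewrite /h0/= (chart_mapK hd)//; exact: Sd|left].
have himg z : S z -> chart_img d (h z) /\ mdist (g z) (chart_inv d (h z)) < e.
  move=> Sz; have [Lz|nLz] := pselect (L z).
    by have [Hz hr] := Hh z Sz; exact: rP.
  rewrite hE; last by left.
  by rewrite /h0/= (chart_mapK hd) ?mdistxx//; [split=> //; exists (g z) => //|];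
    exact: Sd.
have dg' z : S z -> chart_dom d (g' z) /\ chart_map d (g' z) = h z.
  move=> Sz; rewrite /g'; case: pselect => // Sz'.
  by have [[y dy <-] dy'] := himg z Sz; rewrite (chart_mapK hd).
have nS z : ~ S z -> \forall y \near z, g' y = g y.
  move=> nSz; have : nbhs z (~` L).
    by apply: open_nbhs_nbhs; split; [exact: closed_openC|move=> /LS].
  by apply: filterS => y; exact: nSg.
have nearS z : S z -> nbhs z S by move=> Sz; exact: open_nbhs_nbhs.
have dgn z : S z -> \forall y \near z, chart_dom d (g y).
  by move=> /nearS; apply: filterS.
have sg' z : S z -> smooth_at k A h z -> smooth_map_at k A B g' z.
  move=> Sz sh; exists d; split=> //.
    by apply: filterS (nearS z Sz) => y /dg' [].
  by apply: smooth_at_eq sh; apply: filterS (nearS z Sz) => y /dg' [_ <-].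
have mono' z : smooth_map_at k A B g z -> smooth_map_at k A B g' z.
  have [Sz|nSz] := pselect (S z) => sgz.
    by apply: sg' => //; apply: mono; apply: (smooth_map_at_chart hN) => //; exact: dgn.
  by apply: smooth_map_at_eq sgz; apply: filterS (nS z nSz) => y ->.
exists g'; split=> //.
- move=> z; have [Sz|nSz] := pselect (S z); last first.
    rewrite /continuous_at (nbhs_singleton (nS z nSz)).
    by apply: cvg_trans (cg z); apply: near_eq_cvg; apply: filterS (nS z nSz) => y ->.
  have [dz hz] := dg' z Sz.
  move=> U /(chart_inv_continuous_at hN Bd dz); rewrite hz => /(ch z Sz).
  apply: filterS2 (nearS z Sz) => y Sy /= hU.
  have [imy _] := himg y Sy.
  by rewrite /g'; case: pselect => // Sy'; exact: hU.
- move=> z; rewrite /g'; case: pselect => [Sz|nSz]; last by rewrite mdistxx.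
  by have [] := himg z Sz.
- move=> z Dz; rewrite /g'; case: pselect => // Sz.
  by rewrite hE; [rewrite /h0/= (chart_mapK hd)//; exact: Sd|right].
- move=> z Tz; have [Wz|nWz] := pselect (W z); first exact: mono'.
  apply: sg'; last exact: sT.
  by apply: LS; exact: interior_subset (TL z Tz).
Qed.

(** The maps to be modified are the perturbations [g1] of [g] rather than [g] itself.
This makes the notion stable under unions: after [g1] has been smoothed on a first
set, by a small enough move, the result is still a perturbation of [g], to which
the property on the second set applies. *)
Definition smoothable_near (g : M -> N) (S : set M) :=
  exists2 delta : R, 0 < delta & forall g1 D e, continuous g1 ->
    (forall z, mdist (g z) (g1 z) < delta) -> closed D ->
    (forall z, D z -> smooth_map_at k A B g1 z) -> 0 < e ->
    exists g' : M -> N, [/\ continuous g', forall z, mdist (g1 z) (g' z) < e,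
      forall z, D z -> g' z = g1 z,
      forall z, smooth_map_at k A B g1 z -> smooth_map_at k A B g' z &
      forall z, S z -> smooth_map_at k A B g' z].

(** Locally, [g] maps a neighbourhood [S] of the given point well inside the domain
of a chart [d] of [N]; a perturbation of [g] still maps [S] into that domain, and
[smooth_in_chart] applies to it. *)
Lemma smoothable_near_compact (g : M -> N) (K : set M) :
  continuous g -> compact K -> smoothable_near g K.
Proof.
move=> cg cK; apply: compact_induction cK _ _ _ _.
- by exists 1 => // g1 D e cg1 _ _ sD e0; exists g1; split=> // z; rewrite mdistxx.
- move=> X Y XY [dl dl0 H]; exists dl => // g1 D e cg1 gg1 cD sD e0.
  have [g' [? ? ? ? sY]] := H g1 D e cg1 gg1 cD sD e0.
  by exists g'; split=> // z /XY; exact: sY.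
- move=> X Y [d1 d10 H1] [d2 d20 H2].
  have dl0 : 0 < Num.min d1 (d2 / 2) by rewrite lt_min d10 divr_gt0.
  exists (Num.min d1 (d2 / 2)) => // g1 D e cg1 gg1 cD sD e0.
  (* half of [d2] is left for the distance from [g] to [g1], half for the move *)
  have e10 : 0 < Num.min (e / 2) (d2 / 2) by rewrite lt_min !divr_gt0.
  have [z|g2 [cg2 g12 D2 mono2 sX]] := H1 g1 D _ cg1 _ cD sD e10.
    by have := gg1 z; rewrite lt_min => /andP[].
  have e20 : 0 < e / 2 by rewrite divr_gt0.
  have [z|z Dz|g3 [cg3 g23 D3 mono3 sY]] := H2 g2 D _ cg2 _ cD _ e20.
  + have := gg1 z; have := g12 z; rewrite !lt_min => /andP[_ a] /andP[_ b].
    rewrite (le_lt_trans (metric_triangle _ (g1 z) _))//.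
    by rewrite [ltRHS]splitr ltrD.
  + by apply: mono2; exact: sD.
  exists g3; split=> //.
  + move=> z; have := g12 z; have := g23 z; rewrite lt_min => a /andP[b _].
    rewrite (le_lt_trans (metric_triangle _ (g2 z) _))//.
    by rewrite [ltRHS]splitr ltrD.
  + by move=> z Dz; rewrite D3// D2.
  + by move=> z /mono2/mono3.
  + by move=> z [/sX/mono3//|/sY].
move=> x _; have [d Bd dx] := atlas_cover hN (g x).
have /nbhs_ballP [eta eta0 sub] := dom_nbhs hN Bd dx.
have eta20 : 0 < eta / 2 by rewrite divr_gt0.
have nS : nbhs x [set z | ball (g x) (eta / 2) (g z)].
  exact: (cg x _ (nbhsx_ballx (g x) _ eta20)).
have [L [cL LS Lx]] := exists_compact_nbhs hM (nbhs_interior nS).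
have [T [cT TL Tx]] := exists_compact_nbhs hM (nbhs_interior Lx).
exists T => //; exists (eta / 2) => // g1 D e cg1 gg1 cD sD e0.
apply: (smooth_in_chart cg1 Bd _ cL LS) => //; first exact: open_interior.
move=> z /interior_subset /= gz; apply: sub.
rewrite [eta]splitr; apply: (ball_triangle gz).
by rewrite ballEmdist; exact: gg1.
Qed.

(** Successive smoothing on compact sets [C i] whose interiors cover [M]. The step of
index [i] is made with error [e / 2 ^ (i + 1)] and keeps the map unchanged on the
union [D i] of the previous sets. Hence the maps [u j] with [j > i] all agree on
[C i], where [u i.+1] is smooth, and every point of [M] is interior to some
[C i]. *)
Lemma Ck_approximation (f : M -> N) (e : R) : continuous f -> 0 < e ->
  exists g, Ck_map k A B g /\ forall x, mdist (f x) (g x) <= e.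
Proof.
move=> cf e0.
have [C [cC nC]] : exists C : nat -> set M, (forall i, compact (C i)) /\
    forall x : M, exists i, nbhs x (C i).
  apply: compact_sequence_cover; first exact: manifold_countable_base hM.
  move=> x; have xT : nbhs x setT by exact: filterT.
  by have [S [cS _ Sx]] := exists_compact_nbhs hM xT; exists S.
pose D := fix D i : set M := if i is j.+1 then D j `|` C j else set0.
have cD i : closed (D i).
  elim: i => [|i IH]; first exact: closed0.
  apply: closedU => //; apply: compact_closed (cC i).
  exact: manifold_hausdorff hM.
have Dsub i j : (i <= j)%N -> D i `<=` D j.
  move=> /subnK <-; elim: (j - i)%N => [//|l IH].
  by apply: subset_trans IH _ => x; left.
(* the recursion is on all pairs of an index and a map; it is meaningful on the
   pairs that satisfy [good] *)
pose good i (g : M -> N) :=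
  continuous g /\ forall z, D i z -> smooth_map_at k A B g z.
have /choice [step stepP] : forall ig : nat * (M -> N), exists g' : M -> N,
    good ig.1 ig.2 -> [/\ good ig.1.+1 g',
      forall z, mdist (ig.2 z) (g' z) < e * 2^-1 ^+ ig.1.+1 &
      forall z, D ig.1 z -> g' z = ig.2 z].
  move=> [i g] /=; have [[cg sD]|ng] := pselect (good i g); last by exists g.
  have [dl dl0 H] := smoothable_near_compact cg (cC i).
  have ei0 : 0 < e * 2^-1 ^+ i.+1 by rewrite mulr_gt0// exprn_gt0.
  have [z|g' [cg' dg' Dg' mono sC]] := H g (D i) _ cg _ (cD i) sD ei0.
    by rewrite mdistxx.
  exists g' => _; split=> //; split=> // z [Dz|Cz]; last exact: sC.
  by apply: mono; exact: sD.
pose u := fix u i := if i is j.+1 then step (j, u j) else f.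
have gu i : good i (u i).
  by elim: i => [|i IH]; [split|have [] := stepP (i, u i) IH].
have uD l j z : (l <= j)%N -> D l z -> u j z = u l z.
  move=> /subnK <- Dz; elim: (j - l)%N => [//|i IH].
  have [_ _ E] := stepP (_, _) (gu (i + l)%N).
  by rewrite -IH; apply: E; exact: Dsub (leq_addl _ _) _ Dz.
have du i z : mdist (f z) (u i z) <= e * (1 - 2^-1 ^+ i).
  elim: i => [|i IH]; first by rewrite mdistxx expr0 subrr mulr0.
  have [_ /(_ z) /ltW /= dz _] := stepP (_, _) (gu i).
  rewrite (le_trans (metric_triangle _ (u i z) _))// (le_trans (lerD IH dz))//.
  rewrite -mulrDr ler_pM2l// exprS; lra.
have /choice [ix hix] : forall x, exists i, C i x.
  by move=> x; have [i Ci] := nC x; exists i; exact: nbhs_singleton Ci.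
(* the limit, read at an index from which the sequence is stationary at [x] *)
pose g x := u (ix x).+1 x.
have gE j x : C j x -> g x = u j.+1 x.
  move=> Cx; rewrite /g.
  rewrite -(@uD (ix x).+1 (maxn (ix x).+1 j.+1)) ?leq_maxl//; last by right.
  by rewrite -[RHS](@uD j.+1 (maxn (ix x).+1 j.+1)) ?leq_maxr//; right.
exists g; split.
  apply: (smooth_map_at_Ck_map hM) => x; have [j Cj] := nC x.
  have sx : smooth_map_at k A B (u j.+1) x.
    by have [_] := gu j.+1; apply; right; exact: nbhs_singleton Cj.
  by apply: smooth_map_at_eq sx; apply: filterS Cj => y /gE ->.
by move=> x; rewrite (le_trans (du _ x))// ler_piMr ?ltW// gerBl.
Qed.

End approximation.

(** * Distortions under perturbation *)

Section distortion.
Context {R : realType}.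
Local Open Scope ereal_scope.

Lemma mdist_perturb (X : metricType R) (x x' y y' : X) (a b : R) :
  (mdist x x' <= a)%R -> (mdist y y' <= b)%R ->
  (`|mdist x y - mdist x' y'| <= a + b)%R.
Proof.
move=> xx' yy'.
have := metric_triangle x x' y; have := metric_triangle x' y' y.
have := metric_triangle x' x y'; have := metric_triangle x y y'.
rewrite (metric_sym y' y) (metric_sym x' x) ler_norml; lra.
Qed.

Lemma norm_sub_perturb (s s' t t' a b e : R) : (a + b <= e)%R ->
  (`|s - s'| <= a)%R -> (`|t - t'| <= b)%R -> (`|s' - t'| <= `|s - t| + e)%R.
Proof.
move=> abe; rewrite !ler_norml => /andP[s1 s2] /andP[t1 t2].
have := ler_norm (s - t); have := ler_norm (t - s); rewrite (distrC t s); lra.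
Qed.

Lemma maxe0_sup_perturb (T : Type) (D : set T) (F G : T -> R) (e : R) :
  (0 <= e)%R -> (forall t, D t -> (G t <= F t + e)%R) ->
  maxe 0 (ereal_sup [set (G t)%:E | t in D]) <=
  maxe 0 (ereal_sup [set (F t)%:E | t in D]) + e%:E.
Proof.
move=> e0 FG; rewrite ge_max; apply/andP; split.
  by rewrite adde_ge0// ?lee_fin// le_max lexx.
apply: ub_ereal_sup => _ [t Dt <-].
apply: (@le_trans _ _ ((F t)%:E + e%:E)); first by rewrite -EFinD lee_fin FG.
by rewrite leeD2r// le_max; apply/orP; right; apply: ereal_sup_ubound; exists t.
Qed.

(** Moving both maps by at most [e / 2] moves each distance that enters a distortion
or the codistortion by at most [e / 2] per endpoint, and in total by at most [e]. *)
Lemma dGH_over_perturb (X Y : metricType R) (F F' : set (X -> Y))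
    (G G' : set (Y -> X)) :
  (forall f (e : R), F f -> (0 < e)%R ->
     exists2 f', F' f' & forall x, (mdist (f x) (f' x) <= e)%R) ->
  (forall g (e : R), G g -> (0 < e)%R ->
     exists2 g', G' g' & forall y, (mdist (g y) (g' y) <= e)%R) ->
  dGH_over F' G' <= dGH_over F G.
Proof.
move=> hF hG; apply: lee_wpmul2l => //.
apply: le_ereal_inf_tmp => _ [[f g] [/= Ff Gg] <-].
apply/lee_addgt0Pr => e e0; have e20 : (0 < e / 2)%R by rewrite divr_gt0.
have [f' Ff' ff'] := hF f _ Ff e20; have [g' Gg' gg'] := hG g _ Gg e20.
apply: (@le_trans _ _ (maxe (maxe (dis f') (dis g')) (codis f' g'))).
  by apply: ereal_inf_lbound; exists (f', g').
have ee : (e / 2 + e / 2 = e)%R by rewrite -splitr.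
have dis_le (V W : metricType R) (h h' : V -> W) :
    (forall v, (mdist (h v) (h' v) <= e / 2)%R) -> dis h' <= dis h + e%:E.
  move=> hh'; apply: maxe0_sup_perturb => [|[v w] _ /=]; first exact: ltW.
  apply: (@norm_sub_perturb _ _ _ _ 0 e); first by rewrite add0r.
    by rewrite subrr normr0.
  by rewrite -[leRHS]ee; exact: mdist_perturb.
have dfg : codis f' g' <= codis f g + e%:E.
  apply: maxe0_sup_perturb => [|[x y] _ /=]; first exact: ltW.
  apply: (@norm_sub_perturb _ _ _ _ (e / 2) (e / 2)); first by rewrite ee.
    by rewrite -[leRHS]add0r; apply: mdist_perturb => //; rewrite mdistxx.
  by rewrite -[leRHS]addr0; apply: mdist_perturb => //; rewrite mdistxx.
have df := dis_le _ _ _ _ ff'; have dg := dis_le _ _ _ _ gg'.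
rewrite ge_max; apply/andP; split; first (rewrite ge_max; apply/andP; split).
- by apply: (le_trans df); rewrite leeD2r// 2!le_max lexx.
- by apply: (le_trans dg); rewrite leeD2r// 2!le_max lexx orbT.
- by apply: (le_trans dfg); rewrite leeD2r// le_max lexx orbT.
Qed.

End distortion.

Theorem theorem4p5 (R : realType) (k : option nat) (m n : nat)
    (M N : metricType R) (A : set (chart R m M)) (B : set (chart R n N))
    (hM : Ck_manifold k A) (hN : Ck_manifold k B) :
  dGH_C M N = dGH_Ck k A B.
Proof.
apply/eqP; rewrite eq_le; apply/andP; split.
  apply: dGH_over_perturb => f e hf e0; exists f.
  - exact: Ck_map_continuous hM hN _ hf.
  - by move=> x; rewrite mdistxx ltW.
  - exact: Ck_map_continuous hN hM _ hf.
  - by move=> x; rewrite mdistxx ltW.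
apply: dGH_over_perturb => f e cf e0.
  by have [g [? ?]] := Ck_approximation hM hN cf e0; exists g.
by have [g [? ?]] := Ck_approximation hN hM cf e0; exists g.
Qed.
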